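(* For any generic $p\in\mathbb R^{3\times 5}$ there is a two dimensional $p$-admissible linear subspace $S$ of $\mathbb R^{3\times 5}$ such that for any 3-point subconfiguration $p'=(p_i\ p_j\ p_k)$ of $p$ ($i,j,k$ distinct), there is some $u\in S$ whose restriction $(u_i\ u_j\ u_k)$ is not an infinitesimal isometry of $p'$.
   Context: For a matrix $p$, $p_i$ denotes its $i$th column. $p$ is generic if the multiset of its entries is algebraically independent over $\mathbb Q$. A matrix $u\in\mathbb R^{n\times k}$ is an infinitesimal isometry of a configuration $p\in\mathbb R^{n\times k}$ if $(u_i-u_j)^T(p_i-p_j)=0$ for all $i,j$; $\mathcal I_p$ denotes the space of infinitesimal isometries of $p$. Let $k\ge n+1$. A linear subspace $S\le\mathbb R^{n\times k}$ is $p$-admissible if (i) $S\cap\mathcal I_p=0$, and (ii) for almost all $x\in\mathbb R^n$ there are a non-zero $u\in S$ and a vector $y\in\mathbb R^n$ such that $(u_i-y)^T(p_i-x)=0$ for all $i=1,\dots,k$. ''For almost all $x$'' means for all $x$ in some open dense subset of $\mathbb R^n$. *)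

(* Defs.v *)
From mathcomp Require Import all_boot all_order all_algebra.
From mathcomp Require Import all_classical all_reals all_analysis.
(* Without its notations, which clash with those of mathcomp-analysis. *)
From mathcomp Require Import (canonicals) mpoly.

Set Implicit Arguments.
Unset Strict Implicit.
Unset Printing Implicit Defensive.

Import GRing.Theory Num.Theory numFieldNormedType.Exports.
Local Open Scope classical_set_scope.
Local Open Scope ring_scope.

(* Algebraic independence over the rationals of the n * k entries of p, taken
   as an indexed family, so that a repeated entry is a dependence.
   mpoly.mmap ratr h q evaluates q at h, embedding its coefficients into R. *)
Definition generic (R : realType) (n k : nat) (p : 'M[R]_(n, k)) : Prop :=
  forall q : mpoly.mpoly (n * k) rat, q != 0 ->
    mpoly.mmap (@ratr R) (fun a => mxvec p 0 a) q != 0.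

(* The points of a configuration are the columns of its matrix, so each
   product below is a 1 x 1 matrix. *)
Definition infinitesimal_isometries (R : realType) (n k : nat)
    (p : 'M[R]_(n, k)) : set 'M[R]_(n, k) :=
  [set u | forall i j : 'I_k,
     (col i u - col j u)^T *m (col i p - col j p) = 0].

Definition almost_all (T : topologicalType) (P : T -> Prop) : Prop :=
  exists U : set T, [/\ open U, dense U & forall x, U x -> P x].

Definition admissible (R : realType) (n k : nat) (p : 'M[R]_(n, k))
    (S : {vspace 'M[R]_(n, k)}) : Prop :=
  [/\ (n.+1 <= k)%N,
      [set u | u \in S] `&` infinitesimal_isometries p = [set 0] &
      almost_all (fun x : 'cV[R]_n =>
        exists (u : 'M[R]_(n, k)) (y : 'cV[R]_n),
          [/\ u \in S, u != 0 &
              forall i : 'I_k, (col i u - y)^T *m (col i p - x) = 0])].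

Definition subconf3 (R : realType) (n k : nat) (i j l : 'I_k)
    (p : 'M[R]_(n, k)) : 'M[R]_(n, 3) :=
  colsub (tnth [tuple i; j; l]) p.

(* Main.v *)
(* Take u_i = B p_i with B = diag(b0, b1, b2) such that some quadric
   q(x) = x^T B x - z^T x - w vanishes at all five points.  With y = z - B x,
   (u_i - y)^T (p_i - x) = q(p_i) - q(x) = - q(x),
   so the condition on x is that it lies on the quadric.  These quadrics form
   a pencil, parametrized by (b1, b2), so through every x passes one of them.
   Along an edge e of p the strain of u is e^T B e.  If it vanished on two edges
   of a triangle for (b1, b2) = (1, 0), then the vectors of squares of the first
   two coordinates of these edges would be parallel, contradicting genericity. *)
Require Import Defs.
From mathcomp Require Import all_boot all_order all_algebra.
From mathcomp Require Import all_classical all_reals all_analysis.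
From mathcomp Require Import (canonicals) mpoly.
From mathcomp Require Import ring lra.

Import GRing.Theory Num.Theory.

Local Open Scope ring_scope.

(** The indeterminates of the polynomial ring, laid out as a configuration: a polynomial expression
    in the entries of [p] is the value at [p] of the same expression in these. *)
Definition variable_mx (n k : nat) : 'M[mpoly.mpoly (n * k) rat]_(n, k) :=
  \matrix_(r, i) mpoly.mpolyX rat (mpoly.mnm1 (mxvec_index r i)).

Lemma map_variable_mx (S : comNzRingType) (f : {rmorphism rat -> S}) n k
    (p : 'M[S]_(n, k)) :
  map_mx (mpoly.mmap f (fun a => mxvec p 0 a)) (variable_mx n k) = p.
Proof.
by apply/matrixP => r i; rewrite !mxE mpoly.mmapX mpoly.mmap1U mxvecE.
Qed.

(** The rational point [v] certifies that the polynomial [q] is nonzero. *)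
Lemma generic_mmap_neq0 (R : realType) n k (p : 'M[R]_(n, k))
    (q : mpoly.mpoly (n * k) rat) (v : 'M[rat]_(n, k)) :
  generic p -> mpoly.mmap idfun (fun a => mxvec v 0 a) q != 0 ->
  mpoly.mmap (@ratr R) (fun a => mxvec p 0 a) q != 0.
Proof.
by move=> pg qv; apply: pg; apply: contraNneq qv => ->; rewrite rmorph0.
Qed.

(* A row vector of coefficients times this matrix lists the values at the points
   p_i of z^T x + w + g x_0 ^ 2. *)
Definition quadric_mx {T : comNzRingType} (p : 'M[T]_(3, 5)) : 'M[T]_5 :=
  \matrix_(a, i) [:: p 0 i; p 1 i; p 2%:R i; 1; p 0 i ^+ 2]`_a.

Lemma map_quadric_mx (S T : comNzRingType) (f : {rmorphism S -> T})
    (p : 'M[S]_(3, 5)) :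
  map_mx f (quadric_mx p) = quadric_mx (map_mx f p).
Proof.
apply/matrixP => -[a alt] i; rewrite !mxE /=.
by case: a alt => [|[|[|[|[|a]]]]] //= _; rewrite ?rmorph1 ?rmorphXn ?mxE.
Qed.

Lemma mulmx_quadric_mx (T : comNzRingType) (c : 'rV[T]_5) (p : 'M[T]_(3, 5)) i :
  (c *m quadric_mx p) 0 i =
    c 0 0 * p 0 i + c 0 1 * p 1 i + c 0 2%:R * p 2%:R i + c 0 3%:R
    + c 0 4%:R * p 0 i ^+ 2.
Proof.
rewrite !mxE !big_ord_recl big_ord0 !mxE /= mulr1 addr0 !addrA.
by do ![congr (_ + _)]; do ?[congr (_ * _)]; do ?congr (c _ _); apply/val_inj.
Qed.

(** At the test points, 0, e_0 and 2 e_0 determine the part quadratic in x_0, and then e_1 and e_2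
    the other two linear coefficients. *)
Lemma generic_det_quadric_mx (R : realType) (p : 'M[R]_(3, 5)) :
  generic p -> \det (quadric_mx p) != 0.
Proof.
move=> pg; rewrite -[X in quadric_mx X](map_variable_mx _ (@ratr R) _ _ p).
rewrite -map_quadric_mx det_map_mx.
(* The columns of v are 0, e_0, e_1, e_2, 2 e_0. *)
pose v : 'M[rat]_(3, 5) := \matrix_(r, i)
  ((r.+1 == i)%:R + 2%:R * ((r == 0) && (i == 4%:R))%:R).
apply: (@generic_mmap_neq0 _ _ _ _ _ v pg).
rewrite -det_map_mx map_quadric_mx map_variable_mx.
apply/det0P => -[c c0 cv]; case/eqP: c0.
have E i := mulmx_quadric_mx _ c v i; rewrite cv in E.
move: (E 0) (E 1) (E 2%:R) (E 3%:R) (E 4%:R); rewrite !mxE /= => E0 E1 E2 E3 E4.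
apply/rowP => -[a alt]; rewrite !mxE.
have -> : Ordinal alt = [:: 0; 1; 2%:R; 3%:R; 4%:R]`_a.
  by case: a alt => [|[|[|[|[|a]]]]] // alt; apply/val_inj.
case: a alt => [|[|[|[|[|a]]]]] //= _; lra.
Qed.

Lemma generic_edges_not_parallel (R : realType) (p : 'M[R]_(3, 5)) i j l :
  generic p -> i != j -> i != l -> j != l ->
  (p 0 i - p 0 j) ^+ 2 * (p 1 i - p 1 l) ^+ 2
    != (p 0 i - p 0 l) ^+ 2 * (p 1 i - p 1 j) ^+ 2.
Proof.
move=> pg ij il jl; rewrite -subr_eq0.
pose F (T : comNzRingType) (p : 'M[T]_(3, 5)) :=
  (p 0 i - p 0 j) ^+ 2 * (p 1 i - p 1 l) ^+ 2
    - (p 0 i - p 0 l) ^+ 2 * (p 1 i - p 1 j) ^+ 2.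
have FE (S T : comNzRingType) (f : {rmorphism S -> T}) q :
    f (F S q) = F T (map_mx f q).
  by rewrite /F !mxE !(rmorphB, rmorphM, rmorphXn).
rewrite -[X in X != 0]/(F _ p) -(map_variable_mx _ (@ratr R) _ _ p) -FE.
(* Columns [i], [j], [l] of [v] are 0, (1, 1, 1) and (1, 2, 3), so the two products are 4 and 1. *)
pose v : 'M[rat]_(3, 5) := \matrix_(r, m)
  ((m == j)%:R + (r.+1)%:R * (m == l)%:R).
apply: (@generic_mmap_neq0 _ _ _ _ _ v pg).
rewrite FE map_variable_mx /F !mxE !eqxx.
by rewrite (negPf ij) (negPf il) (eq_sym l j) (negPf jl).
Qed.

Lemma quadric_mx_inj (R : fieldType) (p : 'M[R]_(3, 5)) (z0 z1 z2 w g : R) :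
  \det (quadric_mx p) != 0 ->
  (forall i, z0 * p 0 i + z1 * p 1 i + z2 * p 2%:R i + w + g * p 0 i ^+ 2 = 0) ->
  [/\ z0 = 0, z1 = 0, z2 = 0 & g = 0].
Proof.
move=> pdet zp; pose c : 'rV[R]_5 := \row_a [:: z0; z1; z2; w; g]`_a.
have c0 : c = 0.
  apply: contraNeq pdet => c0; apply/det0P; exists c => //.
  by apply/rowP => i; rewrite mulmx_quadric_mx !mxE.
by split; [have /rowP/(_ 0) := c0 | have /rowP/(_ 1) := c0
  | have /rowP/(_ 2%:R) := c0 | have /rowP/(_ 4%:R) := c0]; rewrite !mxE.
Qed.

(** With [b] the squares of another coordinate, this interpolation yields a quadric through the five
    points; the sign makes [g] its x_0 ^ 2 coefficient next to [b]. *)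
Lemma quadric_mx_surj (R : fieldType) (p : 'M[R]_(3, 5)) (b : 'I_5 -> R) :
  \det (quadric_mx p) != 0 ->
  exists z0 z1 z2 w g, forall i,
    b i = z0 * p 0 i + z1 * p 1 i + z2 * p 2%:R i + w - g * p 0 i ^+ 2.
Proof.
move=> pdet; pose c := \row_i b i *m invmx (quadric_mx p).
exists (c 0 0), (c 0 1), (c 0 2%:R), (c 0 3%:R), (- c 0 4%:R) => i.
have := mulmx_quadric_mx _ c p i.
rewrite mulmxKV ?unitmxE ?unitfE // mxE => ->; ring.
Qed.

Lemma dot3_eq0 (R : comNzRingType) (x y : 'cV[R]_3) :
  x^T *m y = 0 <->
  x 0 0 * y 0 0 + x 1 0 * y 1 0 + x 2%:R 0 * y 2%:R 0 = 0.
Proof.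
have -> : x 0 0 * y 0 0 + x 1 0 * y 1 0 + x 2%:R 0 * y 2%:R 0 = (x^T *m y) 0 0.
  rewrite mxE !big_ord_recl big_ord0 !mxE addr0 addrA.
  by do ![congr (_ + _)]; do ?[congr (_ * _)]; congr fun_of_matrix; apply/val_inj.
split=> [-> | xy]; first by rewrite mxE.
by apply/matrixP => a b; rewrite !ord1 xy mxE.
Qed.

Lemma diag_mx_isometry (R : comNzRingType) (b : 'rV[R]_3) k (p : 'M[R]_(3, k)) i j :
  (col i (diag_mx b *m p) - col j (diag_mx b *m p))^T *m (col i p - col j p) = 0
  <-> b 0 0 * (p 0 i - p 0 j) ^+ 2 + b 0 1 * (p 1 i - p 1 j) ^+ 2
      + b 0 2%:R * (p 2%:R i - p 2%:R j) ^+ 2 = 0.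
Proof.
rewrite dot3_eq0 mul_diag_mx !mxE.
by split=> <-; ring.
Qed.

Theorem theorem19 (R : realType) (p : 'M[R]_(3, 5)) (p_generic : generic p) :
  exists S : {vspace 'M[R]_(3, 5)},
    [/\ \dim S = 2%N,
        admissible p S &
        forall i j l : 'I_5, i != j -> i != l -> j != l ->
          exists u : 'M[R]_(3, 5),
            u \in S /\
            ~ infinitesimal_isometries (subconf3 i j l p) (subconf3 i j l u)].
Proof.
have pdet := generic_det_quadric_mx _ _ p_generic.
have [z10 [z11 [z12 [w1 [g1 q1]]]]] :=
  quadric_mx_surj _ p (fun i => p 1 i ^+ 2) pdet.
have [z20 [z21 [z22 [w2 [g2 q2]]]]] :=
  quadric_mx_surj _ p (fun i => p 2%:R i ^+ 2) pdet.
(* Diagonal of B for [a] times the quadric of [q1] plus [b] times that of [q2]. *)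
pose d a b : 'rV[R]_3 := \row_r [:: a * g1 + b * g2; a; b]`_r.
pose u a b := diag_mx (d a b) *m p.
have uE a b : u a b = a *: u 1 0 + b *: u 0 1.
  rewrite /u !scalemxAl -mulmxDl -!linearZ -linearD /=; congr (diag_mx _ *m _).
  by apply/rowP => -[r rlt]; rewrite !mxE; case: r rlt => [|[|[|r]]] //= _; ring.
pose S := <<[:: (u 1 0)%R; (u 0 1)%R]>>%VS.
have uS a b : u a b \in S.
  by rewrite uE memvD ?memvZ ?memv_span ?inE ?eqxx ?orbT.
have Su v : v \in S -> exists a b, v = u a b.
  rewrite /S span_cons span_seq1 => /memv_addP[_ /vlineP[a ->] [_ /vlineP[b ->] ->]].
  by exists a, b; rewrite -uE.
have strain a b i j :
    (col i (u a b) - col j (u a b))^T *m (col i p - col j p) = 0 <->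
    (a * g1 + b * g2) * (p 0 i - p 0 j) ^+ 2 + a * (p 1 i - p 1 j) ^+ 2
      + b * (p 2%:R i - p 2%:R j) ^+ 2 = 0.
  by rewrite diag_mx_isometry !mxE.
have rigid a b : infinitesimal_isometries p (u a b) -> a = 0 /\ b = 0.
  move=> iso.
  (* Coefficients in p_i of the vanishing strain of the edge ij, where the
     squares of p_i have been eliminated by means of the quadrics. *)
  have aff j : a * z11 + b * z21 - 2 * a * p 1 j = 0 /\
               a * z12 + b * z22 - 2 * b * p 2%:R j = 0.
    have [|_ -> -> _] := quadric_mx_inj _ p
      (a * z10 + b * z20 - 2 * (a * g1 + b * g2) * p 0 j)
      (a * z11 + b * z21 - 2 * a * p 1 j)
      (a * z12 + b * z22 - 2 * b * p 2%:R j)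
      (a * w1 + b * w2 + (a * g1 + b * g2) * p 0 j ^+ 2 + a * p 1 j ^+ 2
         + b * p 2%:R j ^+ 2) 0 pdet => // i.
    have /strain E := iso i j; rewrite -[RHS]E.
    have Q1 := q1 i; have Q2 := q2 i.
    ring: Q1 Q2.
  (* If [a] were nonzero, [aff] would put all five points on a plane x_1 = const, against [pdet];
     likewise for [b] and x_2. *)
  split; apply/eqP; apply: contraT => nz.
    have [|_ /eqP] :=
      quadric_mx_inj _ p 0 1 0 (- ((a * z11 + b * z21) / (2 * a))) 0 pdet.
    + move=> i; have [/subr0_eq -> _] := aff i; field.
      by rewrite nz.
    + by rewrite oner_eq0.
  have [|_ _ /eqP] :=
    quadric_mx_inj _ p 0 0 1 (- ((a * z12 + b * z22) / (2 * b))) 0 pdet.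
  + move=> i; have [_ /subr0_eq ->] := aff i; field.
    by rewrite nz.
  + by rewrite oner_eq0.
have iso0 : infinitesimal_isometries p 0.
  by move=> i j; apply/dot3_eq0; rewrite !mxE; ring.
(* As 0 is an isometry, rigidity also gives the linear independence of [u 1 0] and [u 0 1]. *)
have u_eq0 a b : u a b = 0 -> a = 0 /\ b = 0.
  by move=> u0; apply: rigid; rewrite u0.
exists S; split.
- suff /eqP -> : free [:: u 1 0; u 0 1] by [].
  rewrite free_cons span_seq1 seq1_free; apply/andP; split.
    apply/vlineP => -[c E]; have [] := u_eq0 1 (- c).
      by rewrite uE E scale1r scaleNr subrr.
    by move=> /eqP; rewrite oner_eq0.
  by apply/eqP => /u_eq0[_ /eqP]; rewrite oner_eq0.
- split=> //.
  + apply/seteqP; split=> v /=.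
      move=> [/Su[a [b ->]] /rigid[-> ->]].
      by rewrite uE !scale0r addr0.
    move=> ->; split; first exact: mem0v.
    exact: iso0.
  + exists setT; split; [exact: openT | by move=> O [z Oz] _; exists z |] => x _.
    (* Values at [x] of the two basic quadrics; the pencil member with coefficients (h2, - h1)
       vanishes at [x], and if h2 = 0 the second quadric does. *)
    pose h1 := x 1 0 ^+ 2 + g1 * x 0 0 ^+ 2
      - (z10 * x 0 0 + z11 * x 1 0 + z12 * x 2%:R 0 + w1).
    pose h2 := x 2%:R 0 ^+ 2 + g2 * x 0 0 ^+ 2
      - (z20 * x 0 0 + z21 * x 1 0 + z22 * x 2%:R 0 + w2).
    have [a [b [ab h]]] : exists a b, ~ (a = 0 /\ b = 0) /\ a * h1 + b * h2 = 0.
      have [-> | h2n0] := eqVneq h2 0.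
        exists 0, 1; split; last by ring.
        by move=> [_ /eqP]; rewrite oner_eq0.
      exists h2, (- h1); split; last by ring.
      by move=> [/eqP]; rewrite (negPf h2n0).
    pose y : 'cV[R]_3 := \col_r
      ([:: a * z10 + b * z20; a * z11 + b * z21; a * z12 + b * z22]`_r
       - d a b 0 r * x r 0).
    exists (u a b), y; split=> //; first by apply/eqP => /u_eq0.
    move=> i; apply/dot3_eq0; rewrite /u mul_diag_mx !mxE /=.
    have Q1 := q1 i; have Q2 := q2 i.
    (* The right-hand side becomes - q(x), and [Q1], [Q2] give q(p_i) = 0. *)
    rewrite -[RHS]oppr0 -h /h1 /h2.
    ring: Q1 Q2.
- move=> i j l ij il jl; exists (u 1 0); split=> // iso.
  pose t := tnth [tuple i; j; l].
  (* For (a, b) = (1, 0) the strain has no x_2 term, so all edges share the ratio - g1. *)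
  have E m m' : (p 1 (t m) - p 1 (t m')) ^+ 2
      = - g1 * (p 0 (t m) - p 0 (t m')) ^+ 2.
    have := iso m m'; rewrite /subconf3 !col_colsub => /strain Emm.
    by apply/eqP; rewrite -subr_eq0 -[X in _ == X]Emm; apply/eqP; ring.
  have Eij := E 0 1; have Eil := E 0 2%:R; rewrite /t /tnth /= in Eij Eil.
  have /eqP[] := generic_edges_not_parallel _ p i j l p_generic ij il jl.
  by rewrite Eij Eil; ring.
Qed.
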